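(* Let $X$ be a complex Hilbert space, let $E=E^*$ and $A=A^*$ be bounded operators on $X$, let $\mathcal{A}(\mu)=\mu E-A$, and let $\lambda\in\mathbb{R}\cap\rho(\mathcal{A})$, i.e. $\lambda\in\mathbb{R}$ and $\lambda E-A$ is bijective. Put $J=(\lambda E-A)^{-1}$, $[x,y]=(Jx,y)$ for $x,y\in X$, and $\mathcal{L}=\{\{Ez,Az\}\mid z\in X\}$. Then: 1. The operator $AJE$ is selfadjoint in the Hilbert space $X$. 2. $AJE$ is a nonnegative operator in the Hilbert space $X$ if and only if the linear relation $\mathcal{L}$ is nonnegative with respect to $[\cdot,\cdot]$. 3. The negative spectrum $\sigma(AJE)\cap(-\infty,0)$ consists only of finitely many eigenvalues with finite multiplicity if and only if the linear relation $\mathcal{L}$ has finitely many negative squares.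
   Context: $(\cdot,\cdot)$ is the inner product of the Hilbert space $X$. A linear relation in $X$ is a linear subspace of $X\times X$. $(X,[\cdot,\cdot])$ is a Krein space. The adjoint of $\mathcal{L}$ with respect to $[\cdot,\cdot]$ is $\mathcal{L}^+=\{\{x,y\}\in X\times X\mid [x,t]=[y,z]\text{ for all }\{z,t\}\in\mathcal{L}\}$; $\mathcal{L}$ is symmetric if $\mathcal{L}\subseteq\mathcal{L}^+$. $\mathcal{L}$ is nonnegative with respect to $[\cdot,\cdot]$ if $[f',f]\geq 0$ for all $\{f,f'\}\in\mathcal{L}$. A closed symmetric relation $\mathcal{L}$ has $\kappa$ negative squares, $\kappa\in\mathbb{N}_0$, if the Hermitian form $\langle\{f,f'\},\{g,g'\}\rangle:=[f,g']=[f',g]$ on $\mathcal{L}$ has $\kappa$ negative squares, that is, there is a $\kappa$-dimensional subspace $\mathcal{M}$ of $\mathcal{L}$ with $[f',f]<0$ for all $\{f,f'\}\in\mathcal{M}\setminus\{0\}$, but no $(\kappa+1)$-dimensional subspace with this property. It has finitely many negative squares if it has $\kappa$ negative squares for some $\kappa\in\mathbb{N}_0$. (The relation $\mathcal{L}$ of the claim is closed and symmetric, in fact selfadjoint, with respect to $[\cdot,\cdot]$.) *)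

(* Defs.v *)
Set Warnings "-notation-overridden,-notation-incompatible-prefix".
From mathcomp Require Export all_boot all_order all_algebra.
From mathcomp Require Export all_classical all_reals all_analysis.
From mathcomp Require Export complex.

Set Implicit Arguments.
Unset Strict Implicit.
Unset Printing Implicit Defensive.

Export Order.TTheory GRing.Theory Num.Theory numFieldNormedType.Exports.

Local Open Scope classical_set_scope.
Local Open Scope ring_scope.
Local Open Scope complex_scope.

(* The order of a numFieldType K is partial: for z : R[i], 0 <= z (resp. z < 0)
   says that z is real and nonnegative (resp. real and negative). *)

Section Subspaces.
Variables (K : fieldType) (V : lmodType K).

Definition linear_subspace (M : set V) :=
  M 0 /\ forall (a : K) (u v : V), M u -> M v -> M (a *: u + v).

Definition lin_indep (k : nat) (v : 'I_k -> V) :=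
  forall c : 'I_k -> K, \sum_(i < k) c i *: v i = 0 -> forall i, c i = 0.

Definition lin_span (k : nat) (v : 'I_k -> V) : set V :=
  [set u | exists c : 'I_k -> K, u = \sum_(i < k) c i *: v i].

Definition has_dim (M : set V) (k : nat) :=
  exists v : 'I_k -> V, lin_indep v /\ M = lin_span v.

Definition finite_dim (M : set V) := exists k, has_dim M k.

End Subspaces.

Section Operators.
Variables (K : numClosedFieldType) (X : normedModType K).
Implicit Types (T E A : X -> X) (P : K -> X -> X).

Definition bounded_operator T := exists M : K, forall x, `|T x| <= M * `|x|.

(* The values of P are bounded operators on a Banach space in all uses, so a
   bijective P mu has a bounded inverse. *)
Definition resolvent_set P : set K := [set mu | bijective (P mu)].

Definition pencil E A : K -> X -> X := fun mu x => mu *: E x - A x.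

Definition spectrum T : set K := ~` resolvent_set (pencil id T).

(* The two-sided inverse of T when T is bijective. *)
Definition inverse_op T : X -> X := 'pinv_(fun=> 0) [set: X] T.

Definition eigenspace_op T (mu : K) : set X := [set x | T x = mu *: x].

Definition eigenvalue_op T (mu : K) := exists2 x, eigenspace_op T mu x & x != 0.

(* Only used for selfadjoint T, where the algebraic multiplicity of an
   eigenvalue is the dimension of its eigenspace. *)
Definition finite_negative_spectrum T :=
  let negative_spectrum := spectrum T `&` [set mu | mu < 0] in
  finite_set negative_spectrum /\
  forall mu, negative_spectrum mu ->
    eigenvalue_op T mu /\ finite_dim (eigenspace_op T mu).

End Operators.

Section Relations.
Variables (K : numClosedFieldType) (X : normedModType K).
Implicit Types (B : X -> X -> K) (L M : set (X * X)) (T : X -> X).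

Definition adjoint_rel B L : set (X * X) :=
  [set p | forall q, L q -> B p.1 q.2 = B p.2 q.1].

Definition symmetric_rel B L := L `<=` adjoint_rel B L.

Definition nonneg_rel B L := forall f f', L (f, f') -> 0 <= B f' f.

Definition negative_subspace B L (k : nat) M :=
  [/\ linear_subspace M, M `<=` L, has_dim M k &
      forall p, M p -> p != 0 -> B p.2 p.1 < 0].

(* The notion is defined for closed symmetric linear relations only. *)
Definition has_negative_squares B L (k : nat) :=
  [/\ linear_subspace L, closed L, symmetric_rel B L,
      exists M, negative_subspace B L k M &
      ~ exists M, negative_subspace B L k.+1 M].

Definition finitely_many_negative_squares B L :=
  exists k, has_negative_squares B L k.

Definition graph_op T : set (X * X) := [set (x, T x) | x in [set: X]].

(* T = T^*, with operators identified with their graphs. *)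
Definition selfadjoint_op B T := adjoint_rel B (graph_op T) = graph_op T.

Definition nonneg_op B T := forall x, 0 <= B (T x) x.

End Relations.

(* Main.v *)
Require Import Defs.
From HB Require Import structures.
From mathcomp Require Import ring lra.

(* Let T = AJE. Since J inverts lambda E - A, also T = EJA, so T is symmetric and
   [Az, Ew] = (Tz, w): along z |-> {Ez, Az} the form on L is the form (Tz, z).
   Both sides of claim 3 are equivalent to the existence of finitely many vectors
   w_i such that (Tx, x) >= 0 whenever x is orthogonal to all w_i.
   - If the form has a maximal negative subspace spanned by z_1, ..., z_k, take
     w_i = T z_i; conversely k > #w independent vectors have a combination
     orthogonal to all w_i.
   - If the negative spectrum consists of mu_1, ..., mu_p with finite-dimensional
     eigenspaces, T is nonnegative on the orthogonal complement of
     \oplus ker(T - mu_i), by spectral mapping for t \prod (t - mu_i)^2.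
   - Given the w_i, a negative number mu that is not an eigenvalue is regular:
     remove the w_i one by one with rank-one perturbations of T, until T >= 0.
     The negative eigenvalues, with multiplicity, are at most #w in number. *)

Local Open Scope classical_set_scope.
Local Open Scope ring_scope.
Local Open Scope complex_scope.

Local Notation Re := complex.Re.
Local Notation Im := complex.Im.

(** * Linear independence and finite dimension *)

Section Families.
Variables (K : fieldType) (V : lmodType K).

Lemma linear_subspaceZ (M : set V) a u : linear_subspace M -> M u -> M (a *: u).
Proof. by move=> [M0 MD] Mu; rewrite -[_ *: _]addr0; apply: MD. Qed.

Lemma linear_subspace_sum (M : set V) k (c : 'I_k -> K) (v : 'I_k -> V) :
  linear_subspace M -> (forall i, M (v i)) -> M (\sum_(i < k) c i *: v i).
Proof.
move=> sM Mv; elim/big_ind: _ => [|x y Mx My|i _]; first exact: sM.1.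
  by rewrite -(scale1r x); apply: sM.2.
exact: linear_subspaceZ.
Qed.

Lemma linear_subspace_span k (v : 'I_k -> V) : linear_subspace (lin_span v).
Proof.
split; first by exists (fun=> 0); rewrite big1 // => i _; rewrite scale0r.
move=> a _ _ [c ->] [d ->]; exists (fun i => a * c i + d i).
rewrite scaler_sumr -big_split; apply: eq_bigr => i _ /=.
by rewrite scalerDl scalerA.
Qed.

Lemma lin_span_mem k (v : 'I_k -> V) i : lin_span v (v i).
Proof.
exists (fun j => (j == i)%:R); rewrite (bigD1 i) //= eqxx scale1r big1 ?addr0 //.
by move=> j /negPf ->; rewrite scale0r.
Qed.

Definition extend k (u : V) (v : 'I_k -> V) (i : 'I_k.+1) : V :=
  oapp v u (unlift ord0 i).

Lemma extend_sum k u (v : 'I_k -> V) (c : 'I_k.+1 -> K) :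
  \sum_(i < k.+1) c i *: extend k u v i =
  c ord0 *: u + \sum_(i < k) c (lift ord0 i) *: v i.
Proof.
rewrite big_ord_recl /extend unlift_none; congr (_ + _).
by apply: eq_bigr => i _; rewrite liftK.
Qed.

Lemma ord_recl_eq0 k (c : 'I_k.+1 -> K) :
  c ord0 = 0 -> (forall i, c (lift ord0 i) = 0) -> forall i, c i = 0.
Proof. by move=> c0 cS i; case: (unliftP ord0 i) => [j|] ->. Qed.

Lemma lin_indep_extend k u (v : 'I_k -> V) :
  lin_indep v -> ~ lin_span v u -> lin_indep (extend k u v).
Proof.
move=> iv nu c; rewrite extend_sum => c0.
have c00 : c ord0 = 0.
  apply/eqP/negP => /negP cn0; apply: nu.
  exists (fun i => - ((c ord0)^-1 * c (lift ord0 i))).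
  have /eqP := c0; rewrite addr_eq0 => /eqP/(congr1 (fun x => (c ord0)^-1 *: x)).
  rewrite scalerA mulVf // scale1r => ->.
  rewrite scalerN scaler_sumr -sumrN; apply: eq_bigr => i _.
  by rewrite scaleNr scalerA.
apply: ord_recl_eq0 => //; apply: (iv (fun i => c (lift ord0 i))).
by move: c0; rewrite c00 scale0r add0r.
Qed.

(** An independent family in [M] of maximal length exists by the bound [N], and it spans [M], since
    a vector outside its span would extend it. *)
Lemma finite_dim_bounded (M : set V) N : linear_subspace M ->
  (forall k (v : 'I_k -> V), lin_indep v -> (forall i, M (v i)) -> (k <= N)%N) ->
  finite_dim M.
Proof.
move=> sM bM.
pose P k := `[< exists v : 'I_k -> V, lin_indep v /\ forall i, M (v i) >].
have P0 : exists k, P k.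
  by exists 0%N; apply/asboolP; exists (fun=> 0); split=> [c _ []|[]].
have PN k : P k -> (k <= N)%N by move=> /asboolP[v [iv Mv]]; exact: bM Mv.
case: (ex_maxnP P0 PN) => k /asboolP[v [iv Mv]] kmax.
exists k, v; split=> //; apply/seteqP; split=> [u Mu|_ [c ->]]; last first.
  exact: linear_subspace_sum.
apply: contrapT => nu; suff : (k.+1 <= k)%N by rewrite ltnn.
apply: kmax; apply/asboolP; exists (extend k u v); split.
  exact: lin_indep_extend.
by move=> i; rewrite /extend; case: (unlift ord0 i) => [j|] /=.
Qed.

End Families.
Arguments extend {K V k}.

(** * The real inner product and norm of a complex Hilbert space *)

Section RealStructure.
Variables (R : realType) (X : completeNormedModType R[i]).
Variable ip : {dot X for Num.conj}.
Hypothesis ip_norm : forall x : X, `|x| ^+ 2 = ip x x.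

(** Real parts move all estimates into the totally ordered field [R]; for a symmetric operator the
    quadratic form is real, so nothing is lost. *)
Definition rip (x y : X) : R := Re (ip x y).
Definition rnorm (x : X) : R := Re `|x|.

Lemma ipC x y : ip x y = Num.conj (ip y x).
Proof. by rewrite hermC /= expr0 mul1r. Qed.

Lemma ipDl x y z : ip (x + y) z = ip x z + ip y z.
Proof. exact: linearDl. Qed.
Lemma ipBl x y z : ip (x - y) z = ip x z - ip y z.
Proof. exact: linearBl. Qed.
Lemma ipZl a x z : ip (a *: x) z = a * ip x z.
Proof. exact: linearZl_LR. Qed.
Lemma ipDr x y z : ip z (x + y) = ip z x + ip z y.
Proof. exact: linearDr. Qed.
Lemma ipBr x y z : ip z (x - y) = ip z x - ip z y.
Proof. exact: linearBr. Qed.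
Lemma ipZr a x z : ip z (a *: x) = Num.conj a * ip z x.
Proof. exact: linearZr_LR. Qed.
Lemma ip0l z : ip 0 z = 0.
Proof. exact: linear0l. Qed.
Lemma ip_suml (I : Type) (r : seq I) (P : pred I) (F : I -> X) z :
  ip (\sum_(i <- r | P i) F i) z = \sum_(i <- r | P i) ip (F i) z.
Proof. exact: linear_sumlz. Qed.
Lemma ip_sumr (I : Type) (r : seq I) (P : pred I) (F : I -> X) z :
  ip z (\sum_(i <- r | P i) F i) = \sum_(i <- r | P i) ip z (F i).
Proof. exact: linear_sumr. Qed.

Lemma Re_conj (z : R[i]) : Re (Num.conj z) = Re z.
Proof. by case: z. Qed.

Lemma Re_mulr (a : R) (z : R[i]) : Re (a%:C * z) = a * Re z.
Proof. by case: z => b c /=; rewrite mul0r subr0. Qed.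

Lemma conj_real (a : R) : Num.conj a%:C = a%:C.
Proof. exact: conjc_real. Qed.

Lemma ripC x y : rip x y = rip y x.
Proof. by rewrite /rip ipC Re_conj. Qed.
Lemma ripDl x y z : rip (x + y) z = rip x z + rip y z.
Proof. by rewrite /rip ipDl raddfD. Qed.
Lemma ripBl x y z : rip (x - y) z = rip x z - rip y z.
Proof. by rewrite /rip ipBl raddfB. Qed.
Lemma ripZl (a : R) x z : rip (a%:C *: x) z = a * rip x z.
Proof. by rewrite /rip ipZl Re_mulr. Qed.
Lemma ripDr x y z : rip z (x + y) = rip z x + rip z y.
Proof. by rewrite ripC ripDl !(ripC z). Qed.
Lemma ripBr x y z : rip z (x - y) = rip z x - rip z y.
Proof. by rewrite ripC ripBl !(ripC z). Qed.
Lemma ripZr (a : R) x z : rip z (a%:C *: x) = a * rip z x.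
Proof. by rewrite ripC ripZl (ripC z). Qed.

Lemma norm_rnorm x : `|x| = (rnorm x)%:C.
Proof. by rewrite RRe_real // normr_real. Qed.

Lemma rip_rnorm x : rip x x = rnorm x ^+ 2.
Proof. by rewrite /rip -ip_norm norm_rnorm -rmorphXn. Qed.

Lemma ip_rnorm x : ip x x = (rnorm x ^+ 2)%:C.
Proof. by rewrite -ip_norm norm_rnorm rmorphXn. Qed.

Lemma rnorm_ge0 x : 0 <= rnorm x.
Proof. by rewrite -ler0c -norm_rnorm normr_ge0. Qed.

Lemma rnormD x y : rnorm (x + y) <= rnorm x + rnorm y.
Proof. by rewrite -lecR rmorphD /= -!norm_rnorm ler_normD. Qed.

Lemma rnormN x : rnorm (- x) = rnorm x.
Proof. by rewrite /rnorm normrN. Qed.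

Lemma rnormB x y : rnorm (x - y) <= rnorm x + rnorm y.
Proof. by rewrite -(rnormN y) rnormD. Qed.

Lemma rdistrC x y : rnorm (x - y) = rnorm (y - x).
Proof. by rewrite -rnormN opprB. Qed.

Lemma rnormZ a x : rnorm (a *: x) = Re `|a| * rnorm x.
Proof.
rewrite {1}/rnorm normrZ norm_rnorm -(RRe_real (normr_real a)).
by rewrite -rmorphM.
Qed.

Lemma rnormZr (a : R) x : rnorm (a%:C *: x) = `|a| * rnorm x.
Proof. by rewrite rnormZ normc_def /= expr0n addr0 sqrtr_sqr. Qed.

Lemma rnorm0_eq0 x : rnorm x = 0 -> x = 0.
Proof. by move=> x0; apply/normr0_eq0; rewrite norm_rnorm x0. Qed.

Lemma rnorm0 : rnorm 0 = 0.
Proof. by rewrite /rnorm normr0. Qed.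

Lemma rnorm_gt0 x : x != 0 -> 0 < rnorm x.
Proof.
move=> x0; rewrite lt_def rnorm_ge0 andbT.
by apply: contra_neq x0 => /rnorm0_eq0.
Qed.

Lemma rnormDsq x y : rnorm (x + y) ^+ 2 = rnorm x ^+ 2 + 2 * rip x y + rnorm y ^+ 2.
Proof. by rewrite -!rip_rnorm ripDl !ripDr (ripC y x); ring. Qed.

Lemma rnormBsq x y : rnorm (x - y) ^+ 2 = rnorm x ^+ 2 - 2 * rip x y + rnorm y ^+ 2.
Proof. by rewrite -!rip_rnorm ripBl !ripBr (ripC y x); ring. Qed.

Lemma discriminant_le (a b c : R) : 0 <= c ->
  (forall t, 0 <= a + 2 * t * b + t ^+ 2 * c) -> b ^+ 2 <= a * c.
Proof.
move=> c0 H; have [c00|cn0] := eqVneq c 0.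
  have [->|b0] := eqVneq b 0; first by rewrite c00; lra.
  (* For [c = 0] the polynomial is affine with slope [2 * b], and it takes the value -1 at this
     point. *)
  have := H (- (a + 1) / (2 * b)); rewrite c00.
  have -> : a + 2 * (- (a + 1) / (2 * b)) * b +
     (- (a + 1) / (2 * b)) ^+ 2 * 0 = -1 by field.
  by lra.
have cp : 0 < c by rewrite lt_def cn0.
have := H (- b / c).
have -> : a + 2 * (- b / c) * b + (- b / c) ^+ 2 * c = (a * c - b ^+ 2) / c.
  by field.
by rewrite pmulr_lge0 ?invr_gt0 // subr_ge0.
Qed.

Lemma rip_le_rnorm x y : `|rip x y| <= rnorm x * rnorm y.
Proof.
rewrite -ler_sqr ?nnegrE ?normr_ge0 ?mulr_ge0 ?rnorm_ge0 //.
rewrite real_normK ?num_real // exprMn.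
apply: discriminant_le; first exact: sqr_ge0.
move=> t; have := sqr_ge0 (rnorm (x + t%:C *: y)).
rewrite rnormDsq ripZr -(rip_rnorm (t%:C *: y)) ripZl ripZr rip_rnorm.
by move=> H; lra.
Qed.

Lemma rip_le_norm x y : rip x y <= rnorm x * rnorm y.
Proof. exact: le_trans (ler_norm _) (rip_le_rnorm x y). Qed.

(** * Completeness with real-valued errors *)

Lemma le_epsilon (a b : R) : (forall e : R, 0 < e -> a <= b + e) -> a <= b.
Proof. by move=> H; apply/ler_addgt0Pr. Qed.

Definition invS (n : nat) : R := n.+1%:R^-1.

Lemma invS_gt0 n : 0 < invS n.
Proof. by rewrite invr_gt0. Qed.

Lemma invS_le (e : R) n : 0 < e -> (Num.truncn e^-1 <= n)%N -> invS n <= e.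
Proof.
move=> e0 Hn; rewrite -[leRHS]invrK lef_pV2 ?posrE ?invr_gt0 // ltW //.
by apply: lt_le_trans (truncnS_gt _) _; rewrite ler_nat.
Qed.

Lemma rcomplete (u : nat -> X) :
  (forall e : R, 0 < e -> exists N, forall m n, (N <= m)%N -> (N <= n)%N ->
     rnorm (u m - u n) < e) ->
  exists l, forall e : R, 0 < e -> exists N, forall n, (N <= n)%N -> rnorm (u n - l) < e.
Proof.
move=> uC.
have : cvg (u @ \oo).
  apply/cauchy_cvgP/cauchy_exP => /= e e0.
  have er : e = (Re e)%:C by rewrite RRe_real // gtr0_real.
  have [|N HN] := uC (Re e); first by rewrite -ltcR -er.
  exists (u N); exists N => // n /= Nn; rewrite -ball_normE /= norm_rnorm er ltcR.
  exact: HN.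
move=> /cvg_ex[l ul]; exists l => e e0.
have /= := @cvgr_dist_lt _ _ _ _ _ u l ul e%:C.
rewrite ltcR => /(_ eventually_filter e0)[N _ HN]; exists N => n Nn.
by have := HN n Nn; rewrite /= norm_rnorm ltcR rdistrC.
Qed.

Lemma rcomplete_geometric (u : nat -> X) (C q : R) : 0 <= q -> q < 1 ->
  (forall n, rnorm (u n.+1 - u n) <= C * q ^+ n) ->
  exists l, forall n, rnorm (u n - l) <= C * q ^+ n / (1 - q).
Proof.
move=> q0 q1 H.
have C0 : 0 <= C by have := le_trans (rnorm_ge0 _) (H 0%N); rewrite expr0 mulr1.
have d0 : 0 < 1 - q by rewrite subr_gt0.
have tail n k : rnorm (u (n + k)%N - u n) <= C * q ^+ n / (1 - q).
  have : rnorm (u (n + k)%N - u n) <= C * q ^+ n * (1 - q ^+ k) / (1 - q).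
    elim: k => [|k IH]; first by rewrite addn0 subrr rnorm0 expr0 subrr mulr0 mul0r.
    rewrite addnS -(subrK (u (n + k)%N) (u _.+1)) -addrA.
    apply: le_trans (rnormD _ _) _; apply: le_trans (lerD (H _) IH) _.
    rewrite exprD exprS le_eqVlt; apply/orP; left; apply/eqP; field.
    by rewrite gt_eqF.
  move=> /le_trans; apply; rewrite ler_pM2r ?invr_gt0 //.
  rewrite ler_piMr ?mulr_ge0 ?exprn_ge0 // lerBlDr lerDl exprn_ge0 //.
have [|l Hl] := @rcomplete u.
  move=> e e0.
  have e20 : 0 < e / 2 by lra.
  have [N HN] : exists N, C * q ^+ N / (1 - q) < e / 2.
    have q1' : `|q| < 1 by rewrite ger0_norm.
    have /cvgrPdist_lt /(_ (e / 2 * (1 - q) / (C + 1))) := cvg_expr q1'.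
    have C1 : 0 < C + 1 by rewrite ltr_wpDl.
    case; first by rewrite !mulr_gt0 ?invr_gt0 //; lra.
    move=> N _ /(_ N (leqnn N)) /=; rewrite sub0r normrN ger0_norm ?exprn_ge0 // => HN.
    exists N; rewrite ltr_pdivrMr //; rewrite ltr_pdivlMr // in HN.
    apply: le_lt_trans HN; rewrite mulrC ler_wpM2l ?exprn_ge0 //; lra.
  have close k : (N <= k)%N -> rnorm (u k - u N) < e / 2.
    by move=> /subnKC <-; exact: le_lt_trans HN.
  exists N => m n Nm Nn.
  rewrite -(subrKA (u N)) -(opprB (u n)) (le_lt_trans (rnormB _ _)) //.
  by rewrite (splitr e) ltrD // close.
exists l => n; apply: le_epsilon => e e0.
have [N HN] := Hl _ e0.
rewrite -(subrKA (u (n + N)%N)) addrC (le_trans (rnormD _ _)) // addrC.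
rewrite lerD //; first by rewrite rdistrC.
by apply/ltW/HN; rewrite leq_addl.
Qed.

(** * Projection, surjectivity criteria and automatic boundedness *)

Definition symmetric_op (T : X -> X) := forall x y, ip (T x) y = ip x (T y).

Lemma symmetric_rip (T : X -> X) : symmetric_op T ->
  forall x y, rip (T x) y = rip x (T y).
Proof. by move=> sT x y; rewrite /rip sT. Qed.

Lemma symmetric_ip_real (T : X -> X) : symmetric_op T ->
  forall x, ip (T x) x = (rip (T x) x)%:C.
Proof.
move=> sT x; rewrite /rip RRe_real //; apply/CrealP.
by rewrite -ipC sT.
Qed.

(** [z] is the component of [x] orthogonal to the closure of the range of [D], obtained as the limit
    of [x - D w] along a minimizing sequence. *)
Lemma projection_range (D : {linear X -> X}) (x : X) :
  exists z, (forall w, rip (D w) z = 0) /\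
    forall e : R, 0 < e -> exists w, rnorm (x - z - D w) < e.
Proof.
pose S := [set r | exists w, r = rnorm (x - D w)].
have infS : has_inf S.
  split; first by exists (rnorm (x - D 0)), 0.
  by exists 0 => _ [w ->]; exact: rnorm_ge0.
pose d := inf S.
have dle w : d <= rnorm (x - D w) by apply: ge_inf; [exact: infS.2 | exists w].
have d0 : 0 <= d.
  apply: lb_le_inf; first exact: infS.1.
  by move=> _ [w ->]; exact: rnorm_ge0.
have /choice[w Hw] : forall n : nat, exists w, rnorm (x - D w) < d + invS n.
  move=> n; have n0 := invS_gt0 n.
  by have [_ [w ->] H] := inf_adherent n0 infS; exists w.
(* parallelogram identity, with the midpoint of D w1 and D w2 in the range *)
have par w1 w2 : rnorm (D w1 - D w2) ^+ 2 <=
    2 * rnorm (x - D w1) ^+ 2 + 2 * rnorm (x - D w2) ^+ 2 - 4 * d ^+ 2.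
  have := dle ((2^-1)%:C *: (w1 + w2)).
  rewrite -(ler_pXn2r (n:=2)) ?nnegrE ?rnorm_ge0 // => H.
  have e1 : D w1 - D w2 = (x - D w2) - (x - D w1).
    by rewrite opprB [RHS]addrC addrA subrK.
  have e2 : x - D ((2^-1)%:C *: (w1 + w2)) =
      (2^-1)%:C *: ((x - D w2) + (x - D w1)).
    have half : (2^-1)%:C *: (x + x) = x.
      rewrite scalerDr -scalerDl -rmorphD.
      have -> : 2^-1 + 2^-1 = 1 :> R by field.
      by rewrite scale1r.
    by rewrite linearZ linearD /= addrACA -opprD scalerBr half (addrC (D w2)).
  rewrite e2 rnormZr exprMn real_normK ?num_real // rnormDsq in H.
  by rewrite e1 rnormBsq; lra.
have wC : forall e : R, 0 < e -> exists N, forall m n, (N <= m)%N -> (N <= n)%N ->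
     rnorm ((x - D (w m)) - (x - D (w n))) < e.
  move=> e e0.
  (* When both distances are below [d + g], the bound [par] is below [8 * d * g + 4 * g ^+ 2], which
     is at most [g * (8 * (d + 1))] because [g <= 1]. *)
  pose g := Num.min 1 (e ^+ 2 / (8 * (d + 1))).
  have g0 : 0 < g by rewrite lt_min ltr01 divr_gt0 ?exprn_gt0 ?mulr_gt0 // ltr_wpDl.
  exists (Num.truncn g^-1).
  have close k : (Num.truncn g^-1 <= k)%N -> rnorm (x - D (w k)) < d + g.
    by move=> Nk; apply: lt_le_trans (Hw k) _; rewrite lerD2l invS_le.
  move=> m n /close Hm /close Hn.
  rewrite opprB addrC subrKA -(ltr_pXn2r (n:=2)) ?nnegrE ?rnorm_ge0 ?(ltW e0) //.
  apply: le_lt_trans (par _ _) _.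
  have g1 : g <= 1 by rewrite ge_min lexx.
  have ge : g * (8 * (d + 1)) <= e ^+ 2.
    by rewrite -ler_pdivlMr ?mulr_gt0 ?ltr_wpDl // ge_min lexx orbT.
  have := rnorm_ge0 (x - D (w m)); have := rnorm_ge0 (x - D (w n)).
  by move: Hm Hn; set a := rnorm _; set b := rnorm _ => *; nra.
have [z /= Hz] := rcomplete _ wC.
have zd : rnorm z <= d.
  apply: le_epsilon => e e0; have e20 : 0 < e / 2 by lra.
  have [N HN] := Hz _ e20.
  pose k := maxn N (Num.truncn (e / 2)^-1).
  have /= := HN k (leq_maxl _ _).
  rewrite rdistrC => H1; have H2 := Hw k.
  have H3 := invS_le _ k e20 (leq_maxr _ _).
  by have := rnormD (z - (x - D (w k))) (x - D (w k)); rewrite subrK; lra.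
exists z; split=> [v|e e0]; last first.
  have [N HN] := Hz _ e0; exists (w N).
  by rewrite addrAC; exact: HN.
(* [z] has minimal norm among the vectors [z + t D v], which makes this quadratic nonnegative; as
   its constant term is 0, the discriminant forces orthogonality. *)
suff H t : 0 <= 0 + 2 * t * rip (D v) z + t ^+ 2 * rnorm (D v) ^+ 2.
  have := discriminant_le _ _ _ (sqr_ge0 _) H; rewrite mul0r => H0.
  by apply/eqP; rewrite -sqrf_eq0 eq_le H0 sqr_ge0.
have dt : d <= rnorm (z + t%:C *: D v).
  apply: le_epsilon => e e0; have [N HN] := Hz _ e0.
  have := dle (w N - t%:C *: v).
  rewrite linearB linearZ /= opprB addrA addrAC => H.
  have := rnormD (z + t%:C *: D v) ((x - D (w N)) - z).
  have -> : z + t%:C *: D v + (x - D (w N) - z) = (x - D (w N)) + t%:C *: D v.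
    by rewrite [LHS]addrC addrA subrK.
  by have := HN N (leqnn N); lra.
have : d ^+ 2 <= rnorm (z + t%:C *: D v) ^+ 2 by rewrite ler_pXn2r ?nnegrE ?rnorm_ge0.
rewrite rnormDsq ripZr (ripC z) rnormZr exprMn real_normK ?num_real //.
have : rnorm z ^+ 2 <= d ^+ 2 by rewrite ler_pXn2r ?nnegrE ?rnorm_ge0.
by lra.
Qed.

(** The lower bound makes preimages of a Cauchy sequence Cauchy, so the range is closed; the
    condition on [z] makes it dense. *)
Lemma bounded_below_surjective (D : {linear X -> X}) (C c : R) :
  0 < c -> (forall x, rnorm (D x) <= C * rnorm x) ->
  (forall x, c * rnorm x <= rnorm (D x)) ->
  (forall z, (forall w, rip (D w) z = 0) -> z = 0) ->
  forall y, exists x, D x = y.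
Proof.
move=> c0 bD cD dD y; have [z [/dD -> Hz]] := projection_range D y.
have /choice[w Hw] : forall n : nat, exists w, rnorm (y - D w) < invS n.
  move=> n; have n0 := invS_gt0 n.
  by have [w] := Hz _ n0; rewrite subr0; exists w.
have small e : 0 < e -> forall n, (Num.truncn e^-1 <= n)%N -> rnorm (y - D (w n)) < e.
  by move=> e0 n Hn; apply: lt_le_trans (Hw n) _; exact: invS_le.
have [|l Hl] := rcomplete w.
  move=> e e0; have e20 : 0 < c * e / 2 by rewrite divr_gt0 ?mulr_gt0.
  exists (Num.truncn (c * e / 2)^-1) => m n /(small _ e20) Hm /(small _ e20) Hn.
  rewrite -(ltr_pM2l c0); apply: le_lt_trans (cD _) _.
  rewrite linearB -(subrKA y) /=.
  by have := rnormD (D (w m) - y) (y - D (w n)); rewrite (rdistrC _ y); lra.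
exists l; apply/esym/eqP; rewrite -subr_eq0; apply/eqP/rnorm0_eq0/eqP.
rewrite eq_le rnorm_ge0 andbT; apply: le_epsilon => e e0; rewrite add0r.
have C0 : 0 < Num.max C 1 by rewrite lt_max ltr01 orbT.
have e20 : 0 < e / 2 by lra.
have e30 : 0 < e / 2 / Num.max C 1 by rewrite divr_gt0.
have [N HN] := Hl _ e30.
pose k := maxn N (Num.truncn (e / 2)^-1).
have := HN k (leq_maxl _ _); rewrite ltr_pdivlMr // => H1.
have H2 := small _ e20 k (leq_maxr _ _).
have H3 := bD (w k - l); rewrite linearB /= in H3.
have H4 : C * rnorm (w k - l) <= rnorm (w k - l) * Num.max C 1.
  by rewrite mulrC ler_wpM2l ?rnorm_ge0 // le_max lexx.
by have := rnormD (y - D (w k)) (D (w k) - D l); rewrite subrKA; lra.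
Qed.

(** Lax-Milgram: Cauchy-Schwarz turns coercivity into a lower bound, and a vector orthogonal to the
    range has form value 0, hence vanishes. *)
Lemma coercive_surjective (D : {linear X -> X}) (C c : R) :
  0 < c -> (forall x, rnorm (D x) <= C * rnorm x) ->
  (forall x, c * rnorm x ^+ 2 <= rip (D x) x) ->
  forall y, exists x, D x = y.
Proof.
move=> c0 bD cD; apply: (bounded_below_surjective D C c) => // [x|z zD].
  have [->|x0] := eqVneq x 0; first by rewrite linear0 rnorm0 mulr0.
  rewrite -(ler_pM2r (rnorm_gt0 _ x0)) -mulrA -expr2.
  exact: le_trans (cD x) (rip_le_norm _ _).
apply: rnorm0_eq0; apply/eqP; rewrite -sqrf_eq0 eq_le sqr_ge0 andbT.
by have := cD z; rewrite zD pmulr_rle0.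
Qed.

(* Gliding hump: if |T y_n| > 4^n |y_n|, the sum of +-3^-n T y_n / |T y_n| with
   suitable signs is an x with |T x| >= (4/3)^n / 2 for all n. *)
Lemma hellinger_toeplitz (T : {linear X -> X}) : symmetric_op T ->
  exists2 C : R, 0 <= C & forall x, rnorm (T x) <= C * rnorm x.
Proof.
move=> /symmetric_rip sT; apply: contrapT => unb.
have /choice[y Hy] : forall n : nat, exists y, 4 ^+ n * rnorm y < rnorm (T y).
  move=> n; apply: contrapT => H; apply: unb; exists (4 ^+ n); first exact: exprn_ge0.
  by move=> x; rewrite leNgt; apply/negP => Hx; apply: H; exists x.
have Ty0 n : 0 < rnorm (T (y n)).
  by apply: le_lt_trans (Hy n); rewrite mulr_ge0 ?exprn_ge0 ?rnorm_ge0.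
pose e n := ((rnorm (T (y n)))^-1)%:C *: T (y n).
have e1 n : rnorm (e n) = 1.
  by rewrite rnormZr ger0_norm ?invr_ge0 ?rnorm_ge0 // mulVf ?gt_eqF.
(* With this sign the new term cannot cancel the component already present along [e n]. *)
pose sg (x : X) n : R := if 0 <= rip x (e n) then 1 else -1.
pose fix u n := if n is m.+1 then u m + (sg (u m) m * 3^-1 ^+ m)%:C *: e m else 0.
have sg1 x n : `|sg x n| = 1 by rewrite /sg; case: ifP => _; rewrite ?normrN normr1.
have du n : rnorm (u n.+1 - u n) <= 1 * 3^-1 ^+ n.
  rewrite /= (addrC (u n)) addrK rnormZr e1 mulr1 normrM sg1 !mul1r.
  by rewrite ger0_norm // exprn_ge0 // invr_ge0.
have [| |x Hx] := rcomplete_geometric u 1 3^-1 _ _ du; [by lra | by lra|].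
have gap n : 3^-1 ^+ n <= `|rip (u n.+1) (e n)|.
  rewrite /= ripDl ripZl rip_rnorm e1 expr1n mulr1 /sg.
  have p0 : 0 <= 3^-1 ^+ n :> R by rewrite exprn_ge0 // invr_ge0.
  case: (lerP 0 (rip (u n) (e n))) => H.
    by rewrite mul1r ger0_norm ?addr_ge0 // lerDr.
  by rewrite ler0_norm mulN1r ?opprB ?lerBrDr ?lerDl; lra.
(* The limit differs from [u n.+1] by at most $3^{-n}/2$ in norm, so half of the component given by
   [gap] survives. *)
have low n : (3^-1) ^+ n / 2 <= `|rip x (e n)|.
  have H1 := gap n; have H2 := Hx n.+1.
  have H3 := rip_le_rnorm (u n.+1 - x) (e n); rewrite e1 mulr1 ripBl in H3.
  have := ler_normD (rip (u n.+1) (e n) - rip x (e n)) (rip x (e n)).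
  rewrite subrK => H4; rewrite exprS in H2.
  have -> : 3^-1 ^+ n / 2 = 3^-1 ^+ n - 1 * (3^-1 * 3^-1 ^+ n) / (1 - 3^-1) :> R by field.
  by lra.
(* Symmetry enters here: $(x, Ty_n) = (Tx, y_n)$, while $4^n |y_n| < |Ty_n|$. *)
have up n : 4 ^+ n * `|rip x (e n)| <= rnorm (T x).
  rewrite /e ripZr -sT normrM ger0_norm ?invr_ge0 ?rnorm_ge0 //.
  rewrite mulrCA ler_pdivrMl //.
  apply: le_trans (ler_wpM2l _ (rip_le_rnorm _ _)) _; first exact: exprn_ge0.
  by rewrite mulrCA mulrC ler_wpM2r ?rnorm_ge0 // ltW.
have bern n : 1 + n%:R / 3 <= (4 / 3) ^+ n :> R.
  elim: n => [|n IH]; first by rewrite mul0r addr0.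
  rewrite exprS -natr1; have n0 : 0 <= n%:R :> R by [].
  have : 4 / 3 * (1 + n%:R / 3) <= 4 / 3 * (4 / 3) ^+ n :> R by rewrite ler_wpM2l; lra.
  by lra.
(* Since $n + 1 > 6|Tx|$, the bound $(1 + n/3)/2$ exceeds $|Tx|$. *)
pose n := Num.truncn (6 * rnorm (T x)).
have key : (4 / 3) ^+ n / 2 <= rnorm (T x).
  rewrite exprMn -mulrA; apply: le_trans (up n).
  by rewrite ler_wpM2l ?exprn_ge0.
have := le_trans (ler_wpM2r _ (bern n)) key; rewrite invr_ge0 ler0n => /(_ isT).
have := truncnS_gt (6 * rnorm (T x)); rewrite -/n -natr1.
by generalize (n%:R : R) (rnorm (T x)); clear=> *; lra.
Qed.

(** * Shifts and the spectrum of a symmetric operator *)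

Lemma symmetric_cauchy_schwarz (F : {linear X -> X}) : symmetric_op F ->
  (forall x, 0 <= rip (F x) x) ->
  forall x y, rip (F x) y ^+ 2 <= rip (F x) x * rip (F y) y.
Proof.
move=> /symmetric_rip sF pF x y; apply: discriminant_le => // t.
have := pF (x + t%:C *: y).
rewrite linearD linearZ /= !ripDl !ripDr !ripZl !ripZr (sF y x) (ripC y).
by move=> H; lra.
Qed.

(** The sign is opposite to that of [pencil id T r], so that products of shifts are monic
    polynomials in [T]. *)
Definition shift (T : X -> X) (r : R[i]) (x : X) := T x - r *: x.

Lemma shift_is_linear (T : {linear X -> X}) r : linear (shift T r).
Proof.
move=> a x y; rewrite /shift linearP scalerBr scalerDr opprD addrACA.
by rewrite !scalerA mulrC.
Qed.
HB.instance Definition _ (T : {linear X -> X}) r :=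
  GRing.isLinear.Build _ _ _ _ (shift T r) (shift_is_linear T r).

Lemma symmetric_shift (T : X -> X) (a : R) :
  symmetric_op T -> symmetric_op (shift T a%:C).
Proof. by move=> sT x y; rewrite /shift ipBl ipBr sT ipZl ipZr conj_real. Qed.

Lemma rip_shift (T : X -> X) (a : R) x :
  rip (shift T a%:C x) x = rip (T x) x - a * rnorm x ^+ 2.
Proof. by rewrite ripBl ripZl rip_rnorm. Qed.

(* If m, the infimum of the numerical range of G, is negative, then F = G - m is
   nonnegative with bounded inverse, and |F x|^2 <= C (F x, x) yields F >= eps. *)
Lemma nonneg_of_no_negative_spectrum (G : {linear X -> X}) : symmetric_op G ->
  (forall a : R, a < 0 -> bijective (shift G a%:C)) ->
  forall x, 0 <= rip (G x) x.
Proof.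
move=> sG bG.
have [C C0 bdG] := hellinger_toeplitz G sG.
(* In the zero space every real number is a lower bound of the form, and the supremum [m] would not
   exist. *)
have [[x1 x10]|X0] := pselect (exists x : X, x != 0); last first.
  move=> x; have -> : x = 0 by apply/eqP/negP => /negP H; apply: X0; exists x.
  by rewrite linear0 /rip ip0l.
pose S := [set c : R | forall x, c * rnorm x ^+ 2 <= rip (G x) x].
have supS : has_sup S.
  split; first exists (- C).
    move=> x; have := rip_le_rnorm (G x) x; rewrite ler_norml => /andP[+ _].
    apply: le_trans; rewrite mulNr lerN2 expr2 mulrA ler_wpM2r ?rnorm_ge0 //.
  exists C => c /(_ x1) H; have n1 : 0 < rnorm x1 ^+ 2 by rewrite exprn_gt0 ?rnorm_gt0.
  rewrite -(ler_pM2r n1); apply: le_trans H _; apply: le_trans (rip_le_norm _ _) _.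
  by rewrite expr2 mulrA ler_wpM2r ?rnorm_ge0.
pose m := sup S.
have mS x : m * rnorm x ^+ 2 <= rip (G x) x.
  have [->|x0] := eqVneq x 0; first by rewrite linear0 /rip ip0l rnorm0 expr0n mulr0.
  have n1 : 0 < rnorm x ^+ 2 by rewrite exprn_gt0 ?rnorm_gt0.
  rewrite -ler_pdivlMr //; apply: ge_sup; first exact: supS.1.
  by move=> c /(_ x); rewrite ler_pdivlMr.
move=> x; apply: le_trans (mS x); rewrite mulr_ge0 ?sqr_ge0 //.
rewrite leNgt; apply/negP => m0.
have sF := symmetric_shift G m sG.
have [C' C'0 bF] := hellinger_toeplitz (shift G m%:C) sF.
have pF y : 0 <= rip (shift G m%:C y) y by rewrite rip_shift subr_ge0.
have [K KF FK] := bG _ m0.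
have linK : linear K.
  move=> a u v; apply: (can_inj KF).
  by rewrite [RHS]linearP /= !FK.
pose K' : {linear X -> X} := HB.pack K (GRing.isLinear.Build _ _ _ _ K linK).
have sK : symmetric_op K' by move=> u v /=; rewrite -{2}(FK u) sF FK.
have [c c0 bK] := hellinger_toeplitz K' sK.
have lowF y : rnorm (shift G m%:C y) ^+ 2 <= C' * rip (shift G m%:C y) y.
  set Fy := shift G m%:C y.
  have := symmetric_cauchy_schwarz (shift G m%:C) sF pF y Fy; rewrite -/Fy rip_rnorm => H.
  have H2 : rip (shift G m%:C Fy) Fy <= C' * rnorm Fy ^+ 2.
    by rewrite expr2 mulrA (le_trans (rip_le_norm _ _)) // ler_wpM2r ?rnorm_ge0 //; exact: bF.
  have [->|n0] := eqVneq (rnorm Fy) 0; first by rewrite expr0n mulr_ge0 ?pF.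
  have n1 : 0 < rnorm Fy ^+ 2 by rewrite exprn_gt0 // lt_def n0 rnorm_ge0.
  rewrite -(ler_pM2r n1) -expr2 (le_trans H) // mulrAC mulrC ler_wpM2r ?pF //.
(* With $F = G - m$ and $c$ bounding $F^{-1}$, $|y|^2 \le c^2 |Fy|^2 \le c^2 C' (Fy, y)$; the added
   ones keep the denominator positive. Thus [m + eps] is again a lower bound, against the choice of
   [m]. *)
pose eps := ((c ^+ 2 + 1) * (C' + 1))^-1.
have d0 : 0 < (c ^+ 2 + 1) * (C' + 1) by rewrite mulr_gt0 ?ltr_wpDl ?sqr_ge0.
have eps0 : 0 < eps by rewrite invr_gt0.
suff : m + eps <= m by lra.
apply: ub_le_sup; first exact: supS.2.
move=> y /=; rewrite mulrDl -lerBrDl -rip_shift /eps ler_pdivrMl //.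
have H1 : rnorm y <= c * rnorm (shift G m%:C y) by have := bK (shift G m%:C y); rewrite /= KF.
have H2 := lowF y; have H3 := pF y.
have H4 : rnorm y ^+ 2 <= c ^+ 2 * rnorm (shift G m%:C y) ^+ 2.
  by rewrite -exprMn ler_pXn2r ?nnegrE ?mulr_ge0 ?rnorm_ge0.
apply: le_trans H4 _; rewrite -[leRHS]mulrA ler_pM ?sqr_ge0 ?lerDl //.
by rewrite (le_trans H2) // ler_wpM2r // lerDl.
Qed.

Lemma linear_bijective (F : {linear X -> X}) :
  (forall x, F x = 0 -> x = 0) -> (forall y, exists x, F x = y) -> bijective F.
Proof.
move=> iF /choice[g Fg]; exists g => // x; apply/eqP; rewrite -subr_eq0; apply/eqP.
by apply: iF; rewrite linearB /= Fg subrr.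
Qed.

Lemma shift_bounded (T : {linear X -> X}) r : symmetric_op T ->
  exists C : R, forall x, rnorm (shift T r x) <= C * rnorm x.
Proof.
move=> sT; have [C _ bT] := hellinger_toeplitz T sT.
exists (C + Re `|r|) => x; rewrite mulrDl (le_trans (rnormB _ _)) //.
by rewrite rnormZ lerD.
Qed.

(** Multiplying $T - (a + ib)$ by $ib$ gives a coercive operator: $(Tx,x)$ is real, so the real part
    of the new form is $b^2 |x|^2$. *)
Lemma shift_nonreal_bijective (T : {linear X -> X}) r : symmetric_op T ->
  r \isn't Num.real -> bijective (shift T r).
Proof.
case: r => a b sT; rewrite complex_real => b0.
have [C bT] := shift_bounded T (a +i* b) sT.
have coer x : b ^+ 2 * rnorm x ^+ 2 = rip ((0 +i* b) *: shift T (a +i* b) x) x.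
  rewrite /rip ipZl ipBl ipZl (symmetric_ip_real T sT) ip_rnorm /=.
  by ring.
have b2 : 0 < b ^+ 2 by rewrite lt_def sqrf_eq0 b0 sqr_ge0.
apply: linear_bijective => [x Hx|y].
  apply: rnorm0_eq0; apply/eqP; have /eqP := coer x.
  by rewrite [shift _ _ _]Hx scaler0 /rip ip0l /= mulf_eq0 (gt_eqF b2) /= sqrf_eq0.
have c0 : (0 +i* b) != 0 :> R[i] by rewrite eq_complex /= negb_and b0 orbT.
have bD x : rnorm (((0 +i* b) \*: shift T (a +i* b)) x) <= (Re `|0 +i* b| * C) * rnorm x.
  by rewrite /= rnormZ -mulrA ler_wpM2l // -ler0c RRe_real ?normr_real.
have [|x Hx] := coercive_surjective _ _ _ b2 bD _ ((0 +i* b) *: y).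
  by move=> x; rewrite coer.
by exists x; apply: (scalerI c0).
Qed.

Lemma shift_coercive_bijective (T : {linear X -> X}) (a : R) : symmetric_op T ->
  (forall x, 0 <= rip (T x) x) -> a < 0 ->
  forall y, exists x, shift T a%:C x = y.
Proof.
move=> sT pT a0; have [C bT] := shift_bounded T a%:C sT.
apply: (coercive_surjective _ C (- a)) => // [|x]; first by rewrite oppr_gt0.
by rewrite rip_shift mulNr lerDr.
Qed.

(** * Polynomials in an operator *)

Section OperatorPolynomials.
Variable T : {linear X -> X}.
Implicit Types (p q : {poly R[i]}).

Definition papp p x := \sum_(i < size p) p`_i *: iter i T x.

Lemma papp_widen p n x : (size p <= n)%N -> papp p x = \sum_(i < n) p`_i *: iter i T x.
Proof.
move=> pn; rewrite /papp (big_ord_widen n (fun i => p`_i *: iter i T x)) //.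
rewrite big_mkcond; apply: eq_bigr => i _; case: ltnP => // pi.
by rewrite nth_default // scale0r.
Qed.

Lemma papp_sub p q x : papp (p - q) x = papp p x - papp q x.
Proof.
pose n := maxn (size (p - q)%R) (maxn (size p) (size q)).
rewrite !(papp_widen _ n) /n ?leq_max ?leqnn ?orbT //.
by rewrite -sumrB; apply: eq_bigr => i _; rewrite coefB scalerBl.
Qed.

Lemma papp_scale c p x : papp (c *: p) x = c *: papp p x.
Proof.
rewrite (papp_widen _ (size p)) ?size_scale_leq // scaler_sumr.
by apply: eq_bigr => i _; rewrite coefZ scalerA.
Qed.

Lemma papp_const c x : papp c%:P x = c *: x.
Proof. by rewrite (papp_widen _ 1 _ (size_polyC_leq1 c)) big_ord1 coefC. Qed.

Lemma papp_mulX p x : papp ('X * p) x = T (papp p x).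
Proof.
rewrite (papp_widen _ (size p).+1); last first.
  by rewrite (leq_trans (size_polyMleq _ _)) // size_polyX.
rewrite big_ord_recl coefXM eqxx scale0r add0r linear_sum.
by apply: eq_bigr => i _; rewrite coefXM /= linearZ.
Qed.

Fixpoint prodop (rs : seq R[i]) : {linear X -> X} :=
  if rs is r :: rs' then (shift T r \o prodop rs' : {linear X -> X}) else idfun.

(** A product of shifts thus depends only on the polynomial, which allows one factorization to be
    exchanged for another. *)
Lemma prodop_papp rs x : prodop rs x = papp (\prod_(r <- rs) ('X - r%:P)) x.
Proof.
elim: rs => [|r rs IH] /=; first by rewrite big_nil -polyC1 papp_const scale1r.
by rewrite big_cons mulrBl papp_sub papp_mulX -IH mul_polyC papp_scale -IH.
Qed.

Lemma prodop_cat rs1 rs2 x : prodop (rs1 ++ rs2) x = prodop rs1 (prodop rs2 x).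
Proof. by elim: rs1 => //= r rs ->. Qed.

(** Spectral mapping: [rs'] lists the roots of $p - \nu$, where $p$ has the roots [rs]. As [rs] is
    nonempty, $p$ is nonconstant and $p - \nu$ stays monic. *)
Lemma prodop_sub (rs : seq R[i]) (nu : R[i]) : rs != [::] ->
  exists rs', (forall x, prodop rs x - nu *: x = prodop rs' x) /\
    forall r, r \in rs' -> \prod_(s <- rs) (r - s) = nu.
Proof.
move=> rs0; pose p := \prod_(r <- rs) ('X - r%:P) - nu%:P.
have lp : lead_coef p = 1.
  rewrite lead_coefDl ?(monicP (monic_prod_XsubC _ _ _)) //.
  rewrite size_opp size_prod_XsubC (leq_ltn_trans (size_polyC_leq1 _)) //.
  by rewrite ltnS lt0n size_eq0.
have [rs' Hp] := closed_field_poly_normal p; rewrite lp scale1r in Hp.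
exists rs'; split=> [x|r rs'r].
  by rewrite !prodop_papp -Hp papp_sub papp_const.
have : root p r by rewrite Hp root_prod_XsubC.
rewrite /root /p hornerD hornerN hornerC horner_prod subr_eq0 => /eqP <-.
by apply: eq_bigr => s _; rewrite hornerXsubC.
Qed.

Lemma prodop_bijective rs :
  (forall r, r \in rs -> bijective (shift T r)) -> bijective (prodop rs).
Proof.
elim: rs => [_|r rs IH H] /=; first by exists idfun.
apply: bij_comp; first by apply: H; rewrite mem_head.
by apply: IH => s rss; apply: H; rewrite inE rss orbT.
Qed.

Lemma prodop_eigen rs r y : T y = r *: y ->
  prodop rs y = (\prod_(s <- rs) (r - s)) *: y.
Proof.
move=> Ty; elim: rs => [|s rs IH] /=; first by rewrite big_nil scale1r.
by rewrite IH /shift linearZ /= Ty big_cons !scalerA -scalerBl (mulrC _ r) -mulrBl.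
Qed.

Hypothesis sT : symmetric_op T.

Lemma prodop_adjoint rs : (forall r, r \in rs -> r \is Num.real) ->
  forall x y, ip (prodop rs x) y = ip x (prodop (rev rs) y).
Proof.
elim: rs => [//|r rs IH] rr x y /=.
have rrs s : s \in rs -> s \is Num.real by move=> H; apply: rr; rewrite inE H orbT.
have /complex_realP[a ra] : r \is Num.real by rewrite rr ?mem_head.
by rewrite rev_cons -cats1 prodop_cat -IH // ra symmetric_shift.
Qed.

End OperatorPolynomials.

(** * Nonnegativity on a subspace of finite codimension *)

Definition perp (ws : seq X) (x : X) := forall w, w \in ws -> ip w x = 0.

Definition nonneg_off (T : X -> X) (ws : seq X) :=
  forall x, perp ws x -> 0 <= rip (T x) x.

(** This expresses by orthogonality that [M] lies in the span of finitely many vectors; in this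
    form, lists for several sets combine by concatenation. *)
Definition perp_determined (M : set X) :=
  exists ws, forall z, perp ws z -> forall x, M x -> ip x z = 0.

(** Applying the product over [rs] to [x] gives an eigenvector [y] for [r], and subtracting
    [c^-1 *: y] from [x] leaves a vector killed by that product. Distinctness of the roots gives
    [c != 0]. *)
Lemma perp_determined_ker_prodop (T : {linear X -> X}) (rs : seq R[i]) : uniq rs ->
  (forall r, r \in rs -> perp_determined [set x | shift T r x = 0]) ->
  perp_determined [set x | prodop T rs x = 0].
Proof.
elim: rs => [_ _|r rs IH /= /andP[rnrs urs] H].
  by exists [::] => z _ x /= ->; rewrite ip0l.
have [ws1 H1] := H r (mem_head _ _).
have [|ws2 H2] := IH urs; first by move=> s rss; apply: H; rewrite inE rss orbT.
exists (ws1 ++ ws2) => z wz x /= Hx.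
have z1 : perp ws1 z by move=> w Hw; apply: wz; rewrite mem_cat Hw.
have z2 : perp ws2 z by move=> w Hw; apply: wz; rewrite mem_cat Hw orbT.
pose y := prodop T rs x; pose c := \prod_(s <- rs) (r - s).
have Ty : T y = r *: y by apply/eqP; rewrite -subr_eq0; apply/eqP.
have c0 : c != 0.
  rewrite prodf_seq_neq0; apply/allP => s rss; apply/implyP => _.
  by rewrite subr_eq0; apply: contra rnrs => /eqP ->.
have -> : x = c^-1 *: y + (x - c^-1 *: y) by rewrite addrC subrK.
rewrite ipDl ipZl (H1 _ z1 y) ?mulr0 ?add0r //.
apply: (H2 _ z2) => /=.
by rewrite linearB linearZ /= (prodop_eigen _ _ _ _ Ty) scalerA mulVf // scale1r subrr.
Qed.

(* With S the product of the T - mu, the operator S^* T S = T \prod (T - mu)^2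
   is nonnegative, since t \prod (t - mu)^2 is nonnegative on the spectrum of T;
   hence T is nonnegative on the closure of ran S, which is (ker S^* )^\perp. *)
Lemma nonneg_off_of_spectrum (T : {linear X -> X}) (mus : seq R[i]) : symmetric_op T ->
  uniq mus -> (forall mu, mu \in mus -> mu \is Num.real) ->
  (forall mu, mu \in mus -> perp_determined [set x | shift T mu x = 0]) ->
  (forall a : R, a < 0 -> a%:C \notin mus -> bijective (shift T a%:C)) ->
  exists ws, nonneg_off T ws.
Proof.
move=> sT umus rmus kmus bT.
pose S := prodop T mus; pose S' := prodop T (rev mus).
have SS' x y : ip (S' x) y = ip x (S y).
  rewrite /S' prodop_adjoint ?revK // => r; rewrite mem_rev; exact: rmus.
pose G : {linear X -> X} := prodop T (rev mus ++ 0 :: mus).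
have GE x : G x = S' (T (S x)).
  by rewrite /G prodop_cat /= /shift scale0r subr0.
have sG : symmetric_op G.
  move=> x y; rewrite !GE SS' sT.
  by rewrite ipC -SS' -ipC.
have pG : forall x, 0 <= rip (G x) x.
  apply: nonneg_of_no_negative_spectrum => // a a0.
  have [|rs [Hrs rrs]] := prodop_sub T (rev mus ++ 0 :: mus) a%:C.
    by case: (rev mus).
  have -> : shift G a%:C = prodop T rs by apply/funext => x; rewrite -Hrs.
  (* Each factor has a root with $r P^2 = a < 0$, where $P = \prod (r - \mu)$. A real root is
     therefore negative and outside [mus], so its shift is bijective. *)
  apply: prodop_bijective => r /rrs; rewrite big_cat big_cons /= subr0.
  rewrite (perm_big mus) /=; last by rewrite perm_rev.
  rewrite mulrCA -expr2; set P := \prod_(s <- mus) _ => HP.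
  have [rr|] := boolP (r \is Num.real); last exact: shift_nonreal_bijective.
  have Pr : P \is Num.real.
    by rewrite /P big_seq; apply: rpred_prod => s smus; apply: rpredB => //; exact: rmus.
  have /complex_realP[b rb] := rr; rewrite rb.
  have rP0 : r * P ^+ 2 < 0 by rewrite HP ltcR.
  have P2 : 0 <= P ^+ 2 by rewrite real_exprn_even_ge0.
  have P20 : 0 < P ^+ 2.
    rewrite lt_def P2 andbT; apply: contraTneq rP0 => ->; by rewrite mulr0 ltxx.
  apply: bT; first by rewrite -ltcR -rb -(pmulr_llt0 _ P20).
  rewrite -rb; apply: contraTN P20 => rmu.
  by rewrite /P (big_rem r) //= subrr mul0r expr0n ltxx.
have pTS x : 0 <= rip (T (S x)) (S x).
  by have := pG x; rewrite GE /rip SS'.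
have [||ws Hws] := perp_determined_ker_prodop T (rev mus).
- by rewrite rev_uniq.
- by move=> r; rewrite mem_rev; exact: kmus.
exists ws => x wx.
have [z [Sz Hz]] := projection_range S x.
have S'z : S' z = 0.
  apply: rnorm0_eq0; apply/eqP; rewrite -sqrf_eq0 -rip_rnorm.
  by rewrite /rip SS' -/(rip _ _) ripC Sz.
have z0 : z = 0.
  have zx : rip z x = 0 by rewrite /rip (Hws x wx z S'z).
  apply: rnorm0_eq0; apply/eqP; rewrite eq_le rnorm_ge0 andbT.
  apply: le_epsilon => e e0; rewrite add0r.
  have [w Hw] := Hz e e0.
  have [->|n0] := eqVneq (rnorm z) 0; first exact: ltW.
  have np : 0 < rnorm z by rewrite lt_def n0 rnorm_ge0.
  rewrite -(ler_pM2r np) -expr2.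
  have := rip_le_rnorm (x - z - S w) z.
  rewrite !ripBl (Sz w) (ripC x) zx sub0r subr0 normrN rip_rnorm ger0_norm ?sqr_ge0 //.
  by move=> /le_trans; apply; rewrite ler_pM2r // ltW.
have [C C0 bdT] := hellinger_toeplitz T sT.
apply: le_epsilon => e e0.
(* Replacing [x] by [x - v] changes the form by at most $2|Tx||v| + C|v|^2$, which stays below
   [d * M] for $|v| < d \le 1$. *)
pose M := 2 * rnorm (T x) + C + 1.
have M0 : 0 < M by have := rnorm_ge0 (T x); rewrite /M; lra.
pose d := Num.min 1 (e / M).
have d0 : 0 < d by rewrite lt_min ltr01 divr_gt0.
have [w Hw] := Hz d d0; rewrite z0 subr0 in Hw.
have [v Hv Sv] : exists2 v, rnorm v < d & S w = x - v.
  by exists (x - S w) => //; rewrite opprB addrC subrK.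
have := pTS w; rewrite Sv.
rewrite linearB /= !ripBl !ripBr (symmetric_rip T sT v x) (ripC v (T x)).
have := rip_le_rnorm (T x) v; have := rip_le_rnorm (T v) v.
rewrite !ler_norml => /andP[Tv1 Tv2] /andP[Tx1 Tx2].
have d1 : d <= 1 by rewrite ge_min lexx.
have dM : d * M <= e by rewrite -ler_pdivlMr // ge_min lexx orbT.
have v1 : rnorm v <= 1 by rewrite (le_trans (ltW Hv)).
have Tv3 : rip (T v) v <= C * rnorm v.
  apply: le_trans Tv2 _; rewrite -[leRHS]mulr1.
  by apply: ler_pM; rewrite ?rnorm_ge0.
have : (2 * rnorm (T x) + C) * rnorm v <= (2 * rnorm (T x) + C) * d.
  by rewrite ler_wpM2l ?(ltW Hv) // addr_ge0 // mulr_ge0 ?rnorm_ge0.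
rewrite /M in dM.
move: (rnorm (T x)) (rnorm v) (rip (T x) v) (rip (T v) v) (rip (T x) x) Tv3 Tx1 dM.
move=> tx nv a b c; clear -d0; lra.
Qed.

(** * Rank-one perturbations *)

Definition perturb (T : X -> X) (c : R) (u x : X) := T x + (c%:C * ip x u) *: u.

Lemma perturb_is_linear (T : {linear X -> X}) c u : linear (perturb T c u).
Proof.
move=> a x y; rewrite /perturb linearP ipDl ipZl scalerDr addrACA; congr (_ + _).
by rewrite scalerA -scalerDl; congr (_ *: _); ring.
Qed.
HB.instance Definition _ (T : {linear X -> X}) c u :=
  GRing.isLinear.Build _ _ _ _ (perturb T c u) (perturb_is_linear T c u).

Lemma symmetric_perturb (T : X -> X) c u : symmetric_op T -> symmetric_op (perturb T c u).
Proof.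
move=> sT x y; rewrite /perturb ipDl ipDr sT ipZl ipZr rmorphM /= conj_real.
by rewrite -ipC mulrAC.
Qed.

Lemma shift_perturb (T : X -> X) c u r x :
  shift (perturb T c u) r x = shift T r x + (c%:C * ip x u) *: u.
Proof. by rewrite /shift /perturb addrAC. Qed.

(** As in the Sherman-Morrison formula, a solution [x1] of the perturbed equation for [y] is
    corrected by a multiple of the solution [v] for [u]. *)
Lemma perturb_surjective (T : {linear X -> X}) (c : R) u r :
  (forall x, shift T r x = 0 -> x = 0) ->
  (forall y, exists x, shift (perturb T c u) r x = y) ->
  forall y, exists x, shift T r x = y.
Proof.
move=> iT sG y; have [x1 Hx1] := sG y; have [v Hv] := sG u.
rewrite !shift_perturb in Hx1 Hv.
have {}Hx1 : shift T r x1 = y - (c%:C * ip x1 u) *: u by rewrite -Hx1 addrK.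
have {}Hv : shift T r v = (1 - c%:C * ip v u) *: u.
  by rewrite scalerBl scale1r; apply/esym/eqP; rewrite subr_eq Hv.
have [k0|k0] := eqVneq (1 - c%:C * ip v u) 0.
  have v0 : v = 0.
    by apply: iT; rewrite Hv k0 scale0r.
  by move: k0 => /eqP; rewrite v0 ip0l mulr0 subr0 oner_eq0.
exists (x1 + (c%:C * ip x1 u / (1 - c%:C * ip v u)) *: v).
rewrite linearD linearZ /= Hx1 Hv scalerA divfK //.
by rewrite subrK.
Qed.

(* If T + u (x) u - r has a kernel, then u = (T - r) x with (x, u) = -1; this
   excludes a kernel of T + 2 u (x) u - r. *)
Lemma perturb_injective (T : {linear X -> X}) u r :
  (forall x, shift T r x = 0 -> x = 0) ->
  exists2 c : R, 1 <= c & forall x, shift (perturb T c u) r x = 0 -> x = 0.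
Proof.
move=> iT.
have [i1|] := pselect (forall x, shift (perturb T 1 u) r x = 0 -> x = 0).
  by exists 1.
move=> /existsNP[x1 /not_implyP[Hx1 /eqP x10]].
exists 2; first by lra.
move=> x2 Hx2; apply/eqP/negP => /negP x20.
rewrite !shift_perturb in Hx1 Hx2.
have b1 : ip x1 u != 0.
  apply: contraNneq x10 => b0; apply/eqP/iT.
  by rewrite -[LHS]addr0 -[RHS]Hx1 b0 mulr0 scale0r.
have b2 : ip x2 u != 0.
  apply: contraNneq x20 => b0; apply/eqP/iT.
  by rewrite -[LHS]addr0 -[RHS]Hx2 b0 mulr0 scale0r.
(* The coefficients cancel the two multiples of [u]. Pairing the resulting relation with [u] gives
   $(2 - 1)(x_1,u)(x_2,u) = 0$. *)
have : (ip x2 u * 2%:C) *: x1 - ip x1 u *: x2 = 0.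
  apply: iT; rewrite linearB !linearZ /=.
  have /eqP := Hx1; rewrite addr_eq0 => /eqP ->.
  have /eqP := Hx2; rewrite addr_eq0 => /eqP ->.
  rewrite !scalerN !scalerA -opprB opprK; apply/eqP; rewrite oppr_eq0 addrC subr_eq0.
  by apply/eqP; congr (_ *: _); rewrite /=; ring.
move=> /(congr1 (fun z => ip z u)); rewrite ipBl !ipZl ip0l => /eqP.
have -> : ip x2 u * 2%:C * ip x1 u - ip x1 u * ip x2 u = ip x1 u * ip x2 u.
  have -> : 2%:C = 2 :> R[i] by exact: rmorph_nat (real_complex R) 2%N.
  by ring.
by rewrite mulf_eq0 (negPf b1) (negPf b2).
Qed.

(* The form of T + Tm (x) Tm is the form of T composed with x' = x + (x, Tm) m, the
   T-orthogonal projection along m; since span(m, x') meets w^\perp in a vector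
   with nonzero x'-component and T is nonnegative there, (Tx', x') >= 0. *)
Lemma nonneg_off_perturb (T : {linear X -> X}) ws w m (c : R) : symmetric_op T ->
  nonneg_off T (w :: ws) -> perp ws m -> rip (T m) m = -1 -> 1 <= c ->
  nonneg_off (perturb T c (T m)) ws.
Proof.
move=> sT nT pm qm c1 x px; set u := T m; pose b := ip x u.
have [x' x'E] : exists x', x' = x + b *: m by eexists.
have um : ip u m = -1 by rewrite /u (symmetric_ip_real T sT) qm rmorphN.
have mu : ip m u = -1 by rewrite ipC um rmorphN rmorph1.
have perpD k y z : perp ws y -> perp ws z -> perp ws (y + k *: z).
  by move=> Hy Hz v vws; rewrite ipDr ipZr Hy // Hz // mulr0 addr0.
have px' : perp ws x' by rewrite x'E; exact: perpD.
have x'u : ip x' u = 0 by rewrite x'E ipDl ipZl mu mulrN1 subrr.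
have ux' : ip u x' = 0 by rewrite ipC x'u conjC0.
have pTx' : 0 <= rip (T x') x'.
  have wm0 : ip w m != 0.
    apply/negP => /eqP wm; have := nT m.
    rewrite qm ler0N1 => H; suff: false by []; apply: H => v.
    by rewrite inE => /predU1P[->//|]; exact: pm.
  (* [g] makes [x' + g *: m] orthogonal to [w]; the form there is $(Tx',x') - |g|^2$. *)
  pose g := Num.conj (- (ip w x' / ip w m)).
  have py : perp (w :: ws) (x' + g *: m).
    move=> v; rewrite inE => /predU1P[->|]; last exact: perpD.
    by rewrite ipDr ipZr conjCK mulNr divfK // subrr.
  have := nT _ py; rewrite /rip (linearD T) (linearZ_LR T) -/u ipDl !ipDr !ipZl !ipZr.
  rewrite (sT x' m) -/u x'u ux' um !mulr0 !addr0 add0r mulrN1 mulrN.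
  rewrite raddfB /= -normCK -add_Re2_Im2 /= => H.
  by rewrite (le_trans H) // gerBl addr_ge0 ?sqr_ge0.
have bE : b * Num.conj b = (Re b ^+ 2 + Im b ^+ 2)%:C.
  by rewrite add_Re2_Im2 normCK.
have e1 : ip (perturb T c u x) x = ip (T x) x + c%:C * (b * Num.conj b).
  by rewrite /perturb ipDl ipZl -/b (ipC u x) -/b mulrA.
have e2 : ip (T x') x' = ip (T x) x + b * Num.conj b.
  rewrite x'E (linearD T) (linearZ_LR T) -/u ipDl !ipDr !ipZl !ipZr (sT x m) -/u -/b um.
  by rewrite (ipC u x) -/b; ring.
move: pTx'; rewrite /rip e1 e2 bE !raddfD /= !mul0r !subr0.
have := addr_ge0 (sqr_ge0 (Re b)) (sqr_ge0 (Im b)); move: (_ + _ ^+ 2) => s s0 H.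
by have : s <= c * s by [rewrite ler_peMl]; lra.
Qed.

(** Induction on [ws] for all [T]: perturbing along a negative direction [m] removes [w] and keeps
    the shift injective, and surjectivity is then carried back to [T]. *)
Lemma nonneg_off_surjective (ws : seq X) (T : {linear X -> X}) (a : R) :
  symmetric_op T -> nonneg_off T ws -> a < 0 ->
  (forall x, shift T a%:C x = 0 -> x = 0) ->
  forall y, exists x, shift T a%:C x = y.
Proof.
elim: ws T => [|w ws IH] T sT nT a0 iT.
  by apply: shift_coercive_bijective => // x; apply: nT => w.
have [|] := pselect (nonneg_off T ws); first by move=> nT'; exact: IH.
move=> /existsNP[m0 /not_implyP[pm0 /negP]]; rewrite -ltNge => qm0.
pose k := (Num.sqrt (- rip (T m0) m0))^-1.
pose m := k%:C *: m0.
have pm : perp ws m by move=> v vws; rewrite ipZr pm0 ?mulr0.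
have qm : rip (T m) m = -1.
  rewrite /m (linearZ_LR T) ripZl ripZr mulrA -expr2 exprVn sqr_sqrtr ?oppr_ge0 ?ltW //.
  by rewrite invrN mulNr mulVf // lt_eqF.
have [c c1 ic] := perturb_injective T (T m) a%:C iT.
apply: (perturb_surjective T c (T m) a%:C iT).
apply: IH => //; first exact: symmetric_perturb.
exact: nonneg_off_perturb nT pm qm c1.
Qed.

(** * Dimension counts and the negative spectrum *)

(** The matrix of inner products has more rows than columns, so its left kernel contains a nonzero
    coefficient vector. *)
Lemma perp_combination k (v : 'I_k -> X) (ws : seq X) : (size ws < k)%N ->
  exists c : 'I_k -> R[i], (exists i, c i != 0) /\ perp ws (\sum_(i < k) c i *: v i).
Proof.
move=> wk; pose M := \matrix_(i < k, j < size ws) ip (v i) (nth 0 ws j).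
have kM : kermx M != 0.
  by rewrite kermx_eq0 -row_leq_rank -ltnNge (leq_ltn_trans (rank_leq_col _)).
pose r := nz_row (kermx M).
have rM : r *m M = 0 by apply/sub_kermxP; exact: nz_row_sub.
exists (r 0); split.
  have r0 : r != 0 by rewrite nz_row_eq0.
  apply: contrapT => H; move/eqP: r0; apply; apply/rowP => i; rewrite mxE.
  by apply/eqP/negP => /negP ri; apply: H; exists i.
move=> w wws; have wi : (index w ws < size ws)%N by rewrite index_mem.
rewrite ipC ip_suml; suff -> : \sum_(i < k) ip (r 0 i *: v i) w = 0 by rewrite conjC0.
have := congr1 (fun A : 'rV_(size ws) => A 0 (Ordinal wi)) rM.
rewrite [RHS]mxE mxE => rM0; rewrite -[RHS]rM0; apply: eq_bigr => i _.
by rewrite ipZl mxE /= nth_index.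
Qed.

(** The common count for eigenspaces, families of eigenvectors and negative subspaces. *)
Lemma nonneg_off_family_bound (T : X -> X) ws k (v : 'I_k -> X) :
  nonneg_off T ws ->
  (forall c : 'I_k -> R[i], (exists i, c i != 0) ->
     let x := \sum_(i < k) c i *: v i in rip (T x) x < 0) ->
  (k <= size ws)%N.
Proof.
move=> nT neg; rewrite leqNgt; apply/negP => /(perp_combination _ v)[c [c0 pc]].
by have /= := neg c c0; rewrite ltNge nT.
Qed.

Lemma finite_dim_perp_determined (M : set X) : finite_dim M -> perp_determined M.
Proof.
move=> [k [v [_ ->]]]; exists [seq v i | i <- enum 'I_k] => z pz _ [c ->].
rewrite ip_suml big1 // => i _; rewrite ipZl pz ?mulr0 //.
by apply: map_f; rewrite mem_enum.
Qed.

Lemma pencil_id_bijective (T : X -> X) mu :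
  bijective (pencil id T mu) <-> bijective (shift T mu).
Proof.
have oppB : bijective (@GRing.opp X) by exists (@GRing.opp X); exact: opprK.
have -> : pencil id T mu = -%R \o shift T mu.
  by apply/funext => x; rewrite /pencil /= /shift opprB.
split=> H; last exact: bij_comp.
have -> : shift T mu = -%R \o (-%R \o shift T mu).
  by apply/funext => x; rewrite /= opprK.
exact: bij_comp.
Qed.

Lemma linear_subspace_eigenspace (T : {linear X -> X}) mu :
  linear_subspace (eigenspace_op T mu).
Proof.
split; first by rewrite /eigenspace_op /= linear0 scaler0.
move=> a x y; rewrite /eigenspace_op /= => Tx Ty.
by rewrite linearP Tx Ty scalerDr !scalerA mulrC.
Qed.

Lemma eigenvectors_orthogonal (T : X -> X) (a b : R) x y : symmetric_op T ->
  T x = a%:C *: x -> T y = b%:C *: y -> a != b -> ip x y = 0.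
Proof.
move=> sT Tx Ty ab; have := sT x y; rewrite Tx Ty ipZl ipZr conj_real => /eqP.
rewrite -subr_eq0 -mulrBl mulf_eq0 -rmorphB /= => /predU1P[/complexI/eqP|/eqP //].
by rewrite subr_eq0 (negPf ab).
Qed.

Lemma finite_negative_spectrum_nonneg_off (T : {linear X -> X}) : symmetric_op T ->
  finite_negative_spectrum T <-> exists ws, nonneg_off T ws.
Proof.
move=> sT; split=> [[/finite_seqP[s sE] spec]|[ws nT]].
  have sneg mu : mu \in undup s -> (spectrum T `&` [set mu | mu < 0]) mu.
    by rewrite sE /= mem_undup.
  apply: (nonneg_off_of_spectrum T (undup s)) => //.
  - exact: undup_uniq.
  - by move=> mu /sneg[_ /ltr0_real].
  - move=> mu /sneg/spec[_ /finite_dim_perp_determined[ws Hws]].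
    exists ws => z pz x /= /eqP; rewrite subr_eq0 => /eqP; exact: Hws.
  move=> a a0; rewrite mem_undup => /negP nas; apply/pencil_id_bijective.
  apply: contrapT => nb; apply: nas.
  have : (spectrum T `&` [set mu | mu < 0]) a%:C by split=> //=; rewrite ltcR.
  by rewrite sE.
have eig mu : (spectrum T `&` [set mu | mu < 0]) mu -> eigenvalue_op T mu.
  move=> [smu mu0]; have /complex_realP[a muE] := ltr0_real mu0; subst mu.
  rewrite /= ltcR in mu0.
  apply: contrapT => nev; apply: smu; apply/pencil_id_bijective.
  have iT x : shift T a%:C x = 0 -> x = 0.
    move=> /eqP; rewrite subr_eq0 => /eqP Tx; apply/eqP/negP => /negP x0.
    by apply: nev; exists x.
  by apply: linear_bijective => //; exact: nonneg_off_surjective nT mu0 iT.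
split; last first.
  move=> mu Amu; split; first exact: eig.
  have [_ mu0] := Amu; have /complex_realP[a muE] := ltr0_real mu0; subst mu.
  rewrite /= ltcR in mu0.
  apply: (finite_dim_bounded _ _ _ (size ws)); first exact: linear_subspace_eigenspace.
  move=> k v iv ev; apply: (nonneg_off_family_bound T ws k v nT) => c [i ci] /=.
  have Tx := linear_subspace_sum _ _ _ _ c v (linear_subspace_eigenspace T a%:C) ev.
  rewrite /eigenspace_op /= in Tx; rewrite Tx ripZl rip_rnorm nmulr_rlt0 //.
  rewrite exprn_gt0 // rnorm_gt0 //; apply: contra_neq ci => x0; exact: iv.
(* Were the negative spectrum infinite, more than [size ws] eigenvectors for distinct eigenvalues
   could be chosen; they are orthogonal, so the form is diagonal and negative on their span. *)
apply: contrapT => /(infinite_set_fset (size ws).+1)[F FA sF].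
pose s : seq R[i] := finmap.enum_fset F.
have /choice[e He] : forall mu : R[i], exists x,
    (spectrum T `&` [set mu | mu < 0]) mu -> T x = mu *: x /\ x != 0.
  move=> mu; have [/eig[x Tx x0]|nA] := pselect ((spectrum T `&` [set mu | mu < 0]) mu).
    by exists x.
  by exists 0.
pose mu (i : 'I_(size s)) := nth 0 s i.
have Amu i : (spectrum T `&` [set mu | mu < 0]) (mu i) by apply: FA; exact: mem_nth.
have /choice[a muE] : forall i, exists a : R, mu i = a%:C.
  by move=> i; have [_ /ltr0_real/complex_realP] := Amu i.
have a0 i : a i < 0 by have [_] := Amu i; rewrite /= muE ltcR.
have Te i : T (e (mu i)) = (a i)%:C *: e (mu i) by rewrite -muE (He _ (Amu i)).1.
have orth i j : i != j -> ip (e (mu i)) (e (mu j)) = 0.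
  move=> ij; apply: (eigenvectors_orthogonal _ _ _ _ _ sT (Te i) (Te j)).
  apply: contra ij => /eqP aij; rewrite -val_eqE
    -(nth_uniq 0 (ltn_ord i) (ltn_ord j) (finmap.fset_uniq F)).
  by rewrite -/(mu i) -/(mu j) !muE aij.
suff : (size s <= size ws)%N by rewrite leqNgt sF.
apply: (nonneg_off_family_bound T ws _ (fun i => e (mu i)) nT) => c [i0 ci0] /=.
rewrite linear_sum /rip ip_suml raddf_sum /=.
have termE i : Re (ip (T (c i *: e (mu i))) (\sum_j c j *: e (mu j))) =
    a i * rnorm (c i *: e (mu i)) ^+ 2.
  rewrite linearZ /= Te scalerA mulrC -scalerA -/(rip _ _) ripZl; congr (_ * _).
  rewrite -rip_rnorm /rip ip_sumr (bigD1 i) //= big1 ?addr0 // => j ji.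
  by rewrite ipZl ipZr orth 1?eq_sym // !mulr0.
have term_le i : a i * rnorm (c i *: e (mu i)) ^+ 2 <= 0.
  by rewrite mulr_le0_ge0 ?sqr_ge0 ?ltW.
rewrite (bigD1 i0) //= termE -[ltRHS]addr0 ltr_leD //.
  rewrite nmulr_rlt0 // exprn_gt0 // rnorm_gt0 //.
  by rewrite scaler_eq0 negb_or ci0 (He _ (Amu i0)).2.
by apply: sumr_le0 => i _; rewrite termE.
Qed.

(** * Negative squares of the relation, read off from the form of [T] *)

Section NegativeSquares.
Variables (E A T : {linear X -> X}) (B : X -> X -> R[i]).
Hypothesis sT : symmetric_op T.
Hypothesis BT : forall z w, B (A z) (E w) = ip (T z) w.
Hypothesis EA0 : forall z, E z = 0 -> A z = 0 -> z = 0.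

Let L := [set (E z, A z) | z in [set: X]].

Lemma range_pair_sum k (c : 'I_k -> R[i]) (v : 'I_k -> X * X) (z : 'I_k -> X) :
  (forall i, v i = (E (z i), A (z i))) ->
  \sum_(i < k) c i *: v i = (E (\sum_(i < k) c i *: z i), A (\sum_(i < k) c i *: z i)).
Proof.
move=> vz; rewrite !linear_sum; elim/big_rec3: _ => //= i p y x _ ->.
by rewrite vz !linearZ.
Qed.

Lemma negative_squares_dim_le M k ws : nonneg_off T ws ->
  negative_subspace B L k M -> (k <= size ws)%N.
Proof.
move=> nT [_ ML [v [iv Mv]] neg].
have /choice[z vz] : forall i, exists z, v i = (E z, A z).
  move=> i; have [|z _ <-] := ML (v i); last by exists z.
  by rewrite Mv; exact: lin_span_mem.
apply: (nonneg_off_family_bound T ws k z nT) => c [i ci] /=.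
have := neg (\sum_(i < k) c i *: v i); rewrite (range_pair_sum k c v z vz) /= BT.
rewrite (symmetric_ip_real T sT) ltcR; apply.
  by rewrite Mv; exists c; rewrite (range_pair_sum k c v z vz).
by apply: contra_neq ci => /esym p0; apply: iv; rewrite (range_pair_sum k c v z vz).
Qed.

(** A negative vector [x] orthogonal to all [T (z i)] would enlarge the negative subspace by one
    dimension, as the mixed terms of the form vanish. *)
Lemma nonneg_off_of_negative_squares k :
  (exists M, negative_subspace B L k M) ->
  ~ (exists M, negative_subspace B L k.+1 M) ->
  exists ws, nonneg_off T ws.
Proof.
move=> [M [_ ML [v [iv Mv]] neg]] nneg.
have /choice[z vz] : forall i, exists z, v i = (E z, A z).
  move=> i; have [|z _ <-] := ML (v i); last by exists z.
  by rewrite Mv; exact: lin_span_mem.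
exists [seq T (z i) | i <- enum 'I_k] => x px.
rewrite leNgt; apply/negP => qx; apply: nneg.
have Tzx i : ip (T (z i)) x = 0 by apply: px; apply: map_f; rewrite mem_enum.
pose u : 'I_k.+1 -> X * X := extend (E x, A x) v.
pose y (c : 'I_k.+1 -> R[i]) := c ord0 *: x + \sum_(i < k) c (lift ord0 i) *: z i.
have uE c : \sum_(i < k.+1) c i *: u i = (E (y c), A (y c)).
  rewrite /u extend_sum (range_pair_sum k _ v z vz) /y !linearD !linearZ /=.
  by [].
have negy c : (exists i, c i != 0) -> rip (T (y c)) (y c) < 0.
  move=> [i0 ci0]; pose s := \sum_(i < k) c (lift ord0 i) *: z i.
  have sx : ip (T s) x = 0.
    rewrite linear_sum ip_suml big1 // => i _.
    by rewrite linearZ ipZl Tzx mulr0.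
  have xs : ip (T x) s = 0 by rewrite sT ipC sx conjC0.
  have -> : rip (T (y c)) (y c) =
      Re (c ord0 * Num.conj (c ord0)) * rip (T x) x + rip (T s) s.
    rewrite /y -/s /rip (linearD T) (linearZ_LR T) ipDl !ipDr !ipZl !ipZr sx xs !mulr0.
    rewrite addr0 add0r mulrA raddfD /= (symmetric_ip_real T sT x) mulrC Re_mulr mulrC.
    by [].
  rewrite -normCK -add_Re2_Im2 [Re _%:C]/=.
  (* Either the old part is already strictly negative, or its coefficients all vanish and the
     coefficient of [x] is nonzero. *)
  have [s0|s0] : rip (T s) s < 0 \/ forall i, c (lift ord0 i) = 0.
    have [p0|pn0] := eqVneq (\sum_(i < k) c (lift ord0 i) *: v i) 0.
      by right; apply: (iv (fun i => c (lift ord0 i))).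
    left; have := neg _ _ pn0; rewrite (range_pair_sum k _ v z vz) /= BT.
    rewrite (symmetric_ip_real T sT) ltcR; apply.
    by rewrite Mv; exists (fun i => c (lift ord0 i)); rewrite (range_pair_sum k _ v z vz).
  - by rewrite -[ltRHS]addr0 ler_ltD // mulr_ge0_le0 ?(ltW qx) // addr_ge0 ?sqr_ge0.
  have -> : s = 0 by rewrite /s big1 // => i _; rewrite s0 scale0r.
  rewrite linear0 {2}/rip ip0l addr0 nmulr_llt0 //.
  have c0 : c ord0 != 0 by apply: contraNneq ci0 => c0; rewrite (ord_recl_eq0 _ _ c).
  by rewrite -ltcR add_Re2_Im2 exprn_gt0 // normr_gt0.
exists (lin_span u); split.
- exact: linear_subspace_span.
- by move=> _ [c ->]; rewrite uE; exists (y c).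
(* Independence follows from negativity: a vanishing combination has [y c = 0] by [EA0], where the
   form is 0. *)
- exists u; split=> // c; rewrite uE => -[Ey Ay] i.
  apply/eqP/negP => /negP ci; have := negy c (ex_intro _ i ci).
  by rewrite (EA0 (y c) Ey Ay) linear0 /rip ip0l ltxx.
move=> _ [c ->] p0; rewrite uE /= BT (symmetric_ip_real T sT) ltcR; apply: negy.
apply: contrapT => H; move/eqP: p0; apply; rewrite big1 // => i _.
have [->|ci] := eqVneq (c i) 0; first by rewrite scale0r.
by case: H; exists i.
Qed.

(** Conversely, take the least [k] without a negative subspace of dimension [k.+1]: minimality
    supplies one of dimension [k], and for [k = 0] the zero subspace serves. *)
Lemma negative_squares_nonneg_off :
  (exists k, (exists M, negative_subspace B L k M) /\
     ~ (exists M, negative_subspace B L k.+1 M)) <->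
  exists ws, nonneg_off T ws.
Proof.
split=> [[k [Mk Mk1]]|[ws nT]]; first exact: nonneg_off_of_negative_squares Mk Mk1.
pose P k := `[< ~ exists M, negative_subspace B L k.+1 M >].
have exP : exists k, P k.
  exists (size ws); apply/asboolP => -[M /(negative_squares_dim_le _ _ _ nT)].
  by rewrite ltnn.
case: (ex_minnP exP) => k /asboolP Pk kmin; exists k; split=> //.
case: k Pk kmin => [|k] _ kmin; last first.
  apply: contrapT => H; suff : (k.+1 <= k)%N by rewrite ltnn.
  by apply: kmin; exact/asboolP.
exists (lin_span (fun _ : 'I_0 => 0 : X * X)); split.
- exact: linear_subspace_span.
- by move=> _ [c ->]; rewrite big_ord0; exists 0 => //; rewrite !linear0.
- by exists (fun=> 0); split=> // c _ [].
by move=> _ [c ->]; rewrite big_ord0 eqxx.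
Qed.

End NegativeSquares.

(** * Selfadjointness and the inverse of the pencil *)

Lemma selfadjoint_symmetric (T : X -> X) : selfadjoint_op ip T <-> symmetric_op T.
Proof.
split=> [sT x y|sT].
  have : adjoint_rel ip (graph_op T) (x, T x) by rewrite sT; exists x.
  by move=> /(_ (y, T y)) /= -> //; exists y.
apply/seteqP; split=> [[x y] /= adj|_ [x _ <-] _ [y _ <-] /=]; last by rewrite sT.
exists x => //; congr (_, _); apply/eqP; rewrite -subr_eq0; apply/eqP.
apply: rnorm0_eq0; apply/eqP; rewrite -sqrf_eq0 -rip_rnorm; set z := T x - y.
have := adj (z, T z) (ex_intro2 _ _ z I erefl); rewrite /= -sT => xz.
by rewrite /rip {1}/z ipBl xz subrr.
Qed.

Section Pencil.
Variables (E A : {linear X -> X}) (J : X -> X) (lambda : R).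
Hypotheses (sE : symmetric_op E) (sA : symmetric_op A).
Hypothesis JK : cancel J (pencil E A lambda%:C).
Hypothesis KJ : cancel (pencil E A lambda%:C) J.

Lemma symmetric_pencil : symmetric_op (pencil E A lambda%:C).
Proof. by move=> x y; rewrite /pencil ipBl ipBr ipZl ipZr conj_real sE sA. Qed.

Lemma symmetric_pencil_inverse : symmetric_op J.
Proof. by move=> x y; rewrite -{2}(JK x) symmetric_pencil JK. Qed.

Lemma linear_pencil_inverse : linear J.
Proof.
move=> a x y; apply: (can_inj KJ); rewrite JK /pencil (linearP E) (linearP A).
rewrite -{1}(JK x) -{1}(JK y) /pencil !scalerDr !scalerN opprD addrACA.
by rewrite !scalerA mulrC.
Qed.

(* Both sides equal lambda E J E x - E x. *)
Lemma pencil_swap x : E (J (A x)) = A (J (E x)).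
Proof.
have A_E y : A y = lambda%:C *: E y - pencil E A lambda%:C y.
  by rewrite /pencil opprB addrC subrK.
rewrite [RHS]A_E JK [A x]A_E.
have -> : J (lambda%:C *: E x - pencil E A lambda%:C x) = lambda%:C *: J (E x) - x.
  pose J' : {linear X -> X} :=
    HB.pack J (GRing.isLinear.Build _ _ _ _ J linear_pencil_inverse).
  by rewrite -[J]/(J' : X -> X) linearB linearZ /= KJ.
by rewrite linearB linearZ.
Qed.

Lemma symmetric_AJE : symmetric_op (A \o J \o E).
Proof.
by move=> x y /=; rewrite sA symmetric_pencil_inverse sE pencil_swap.
Qed.

(** The range consists of the pairs with $AJf = EJg$; for such a pair, $z = \lambda Jf - Jg$
    satisfies $Ez = f$ and $Az = g$. *)
Lemma pencil_range_closed : closed [set (E z, A z) | z in [set: X]].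
Proof.
move=> [f g] fg.
(* Moving the symmetric operators onto [t] leaves only continuity of the inner product in [f] and
   [g] to be used. *)
have orth t : rip (A (J f) - E (J g)) t = 0.
  have rE h (S : X -> X) : symmetric_op S -> rip (S (J h)) t = rip h (J (S t)).
    by move=> sS; rewrite /rip sS symmetric_pencil_inverse.
  rewrite ripBl !rE //; apply/eqP; rewrite -normr_eq0 eq_le normr_ge0 andbT.
  apply: le_epsilon => e e0; rewrite add0r.
  set a := J (A t); set b := J (E t).
  pose M := rnorm a + rnorm b + 1.
  have M0 : 0 < M by rewrite /M ltr_wpDl // addr_ge0 ?rnorm_ge0.
  have d0 : 0 < e / M by rewrite divr_gt0.
  have d0C : 0 < (e / M)%:C :> R[i] by rewrite ltcR.
  have [_ [[z _ <-] [/= fz gz]]] := fg _ (nbhsx_ballx (f, g) _ d0C).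
  rewrite -ball_normE /= norm_rnorm ltcR in fz.
  rewrite -ball_normE /= norm_rnorm ltcR in gz.
  have zz : rip (E z) a = rip (A z) b.
    rewrite /rip -symmetric_pencil_inverse -sA -symmetric_pencil_inverse -sE.
    by rewrite pencil_swap.
  have -> : rip f a - rip g b = rip (f - E z) a - rip (g - A z) b.
    by rewrite !ripBl zz; ring.
  have Ha := rip_le_rnorm (f - E z) a; have Hb := rip_le_rnorm (g - A z) b.
  apply: le_trans (ler_normB _ _) _; apply: le_trans (lerD Ha Hb) _.
  apply: (@le_trans _ _ (e / M * (rnorm a + rnorm b))).
    by rewrite mulrDr lerD // ler_wpM2r ?rnorm_ge0 ?ltW.
  by rewrite -mulrA ler_piMr ?(ltW e0) // ler_pdivrMl // mulr1 /M lerDl.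
have AE : A (J f) = E (J g).
  apply/eqP; rewrite -subr_eq0; apply/eqP/rnorm0_eq0/eqP.
  by rewrite -sqrf_eq0 -rip_rnorm orth.
exists (lambda%:C *: J f - J g) => //; rewrite !linearB !linearZ /=.
congr (_, _); first by rewrite -AE; exact: JK.
by rewrite AE; exact: JK.
Qed.

End Pencil.

End RealStructure.

(** * The three claims *)

Theorem theorem5p3 (R : realType) (X : completeNormedModType R[i])
    (ip : {dot X for Num.conj})
    (ip_norm : forall x : X, `|x| ^+ 2 = ip x x)
    (E A : {linear X -> X})
    (bE : bounded_operator E) (bA : bounded_operator A)
    (sE : selfadjoint_op ip E) (sA : selfadjoint_op ip A)
    (lambda : R) (lambda_res : resolvent_set (pencil E A) lambda%:C) :
  let J := inverse_op (pencil E A lambda%:C) in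
  let B := fun x y : X => ip (J x) y in
  let L := [set (E z, A z) | z in [set: X]] in
  let AJE := A \o J \o E in
  [/\ selfadjoint_op ip AJE,
      nonneg_op ip AJE <-> nonneg_rel B L &
      finite_negative_spectrum AJE <-> finitely_many_negative_squares B L].
Proof.
move=> J B L AJE.
have {}sE := (selfadjoint_symmetric R X ip ip_norm E).1 sE.
have {}sA := (selfadjoint_symmetric R X ip ip_norm A).1 sA.
have [C' CK KC] := lambda_res.
have JK : cancel J (pencil E A lambda%:C).
  move=> x; apply: pinvK; rewrite inE; exists (C' x) => //; exact: KC.
have KJ : cancel (pencil E A lambda%:C) J.
  by move=> x; apply: (can_inj CK); rewrite JK.
have swap := pencil_swap R X E A J lambda JK KJ.
have sT : symmetric_op R X ip AJE := symmetric_AJE R X ip E A J lambda sE sA JK KJ.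
have BT z w : B (A z) (E w) = ip (AJE z) w by rewrite /B -sE swap.
have linT : linear AJE.
  move=> a x y; rewrite /AJE /= linearP.
  by rewrite (linear_pencil_inverse R X E A J lambda JK KJ) linearP.
pose T : {linear X -> X} := HB.pack AJE (GRing.isLinear.Build _ _ _ _ AJE linT).
have EA0 z : E z = 0 -> A z = 0 -> z = 0.
  move=> Ez Az; apply: (can_inj KJ); rewrite /pencil Ez Az.
  by rewrite (linear0 E) (linear0 A).
have linL : linear_subspace L.
  split; first by exists 0 => //; rewrite !linear0.
  move=> a _ _ [z _ <-] [w _ <-]; exists (a *: z + w) => //.
  by rewrite !linearP.
split.
- exact/(selfadjoint_symmetric R X ip ip_norm).
- split=> [pT _ _ [z _ [<- <-]]|pL x]; first by rewrite BT.
  by rewrite -BT; apply: pL; exists x.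
(* Both conditions pass through [exists ws, nonneg_off T ws]; it remains to supply that [L] is
   linear, closed and symmetric. *)
rewrite (finite_negative_spectrum_nonneg_off R X ip ip_norm T sT).
rewrite -(negative_squares_nonneg_off R X ip E A T B sT BT EA0).
split=> [[k [Mk Mk1]]|[k [_ _ _ Mk Mk1]]]; exists k; split=> //.
  exact: (pencil_range_closed R X ip ip_norm E A J lambda).
move=> _ [z _ <-] _ [w _ <-] /=.
by rewrite BT /B -sA.
Qed.
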